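(* There is an absolute constant $M$ such that, with $c=\sqrt2-1$, the following holds. Let $F:\mathbb{R}^d\to\mathbb{R}^d$ be a twice continuously differentiable vector field with $F(\omega^* )=0$, and let $\sigma_i$ be the singular values of $\mathbf{J}_F(\omega^* )$. Assume that $\gamma\le\sigma_i\le L$ for all $i$, where $0<\gamma\le L$, and let $\tau=\frac{L}{\gamma^2}$. Define $$F^{\mathrm{cons}}(\omega)=F(\omega)+\tau\,\nabla\big(\tfrac12\|F\|^2\big)(\omega)=F(\omega)+\tau\,\mathbf{J}_F(\omega)^{T}F(\omega).$$ Then there exist $\alpha,\beta$ such that the momentum method applied to $F^{\mathrm{cons}}$, $$\omega_{t+1}=\omega_t-\alpha F^{\mathrm{cons}}(\omega_t)+\beta(\omega_t-\omega_{t-1}),$$ converges locally to $\omega^*$ at the rate $O\Big(\big(1-c\frac{\gamma}{L}+M\frac{\gamma^2}{L^2}\big)^t\Big)$.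
   Context: For $0<\rho<1$, a two-step iteration $\omega_{t+1}=V(\omega_t,\omega_{t-1})$ with $V(\omega^*,\omega^* )=\omega^*$ ''converges locally to $\omega^*$ at the rate $O(\rho^t)$'' if there exist a neighbourhood $U$ of $\omega^*$ and a constant $C$ such that for all $\omega_0,\omega_1\in U$ and all $t\ge0$, $\|\omega_t-\omega^*\|\le C\rho^t$. The rate assertion is only meaningful, and is only asserted, when the displayed $\rho$ is less than $1$. *)

(* Defs.v *)
From HB Require Import structures.
From mathcomp Require Import all_boot all_order all_algebra.
From mathcomp Require Import all_classical all_reals all_analysis.
Set Implicit Arguments.
Unset Strict Implicit.
Unset Printing Implicit Defensive.
Import Order.TTheory GRing.Theory Num.Theory.
Import numFieldNormedType.Exports.
Local Open Scope classical_set_scope.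
Local Open Scope ring_scope.

(* Points of R^d are row vectors; their library
   norm is the sup norm (inducing the usual topology), so the Euclidean norm is
   defined here. *)

Definition enorm (R : realType) (d : nat) (v : 'rV[R]_d) : R :=
  Num.sqrt (\sum_(i < d) v 0 i ^+ 2).

(* The library's ['J F w] acts on row vectors from the right: its (i, j) entry
   is the i-th partial derivative of the j-th component.  The transpose gives
   the usual convention. *)
Definition jacobian_mx (R : realType) (n m : nat)
    (F : 'rV[R]_n -> 'rV[R]_m) (w : 'rV[R]_n) : 'M[R]_(m, n) :=
  ('J F w)^T.

Definition gradient (R : realType) (d : nat) (g : 'rV[R]_d -> R)
    (w : 'rV[R]_d) : 'rV[R]_d :=
  \row_(i < d) 'D_(delta_mx 0 i) g w.

Definition cont_diff (R : realType) (n m : nat)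
    (F : 'rV[R]_n -> 'rV[R]_m) : Prop :=
  (forall w, differentiable F w) /\ continuous (jacobian_mx F).

(* [mxvec] flattens the Jacobian matrix so that its derivative is again a
   Jacobian. *)
Definition twice_cont_diff (R : realType) (n m : nat)
    (F : 'rV[R]_n -> 'rV[R]_m) : Prop :=
  cont_diff F /\ cont_diff (fun w => mxvec (jacobian_mx F w)).

Definition singular_value (R : realType) (m n : nat) (A : 'M[R]_(m, n))
    (s : R) : bool :=
  (0 <= s) && eigenvalue (A^T *m A) (s ^+ 2).

Definition consensus (R : realType) (d : nat) (tau : R)
    (F : 'rV[R]_d -> 'rV[R]_d) (w : 'rV[R]_d) : 'rV[R]_d :=
  F w + tau *: gradient (fun u => 2^-1 * enorm (F u) ^+ 2) w.

(* For row vectors, [F w *m J] is the transpose of J^T F(w). *)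
Lemma consensusE (R : realType) (d : nat) (tau : R)
    (F : 'rV[R]_d -> 'rV[R]_d) (w : 'rV[R]_d) :
  differentiable F w ->
  consensus tau F w = F w + tau *: (F w *m jacobian_mx F w).
Proof.
move=> dF; rewrite /consensus; congr (_ + _ *: _).
apply/rowP => i; rewrite !mxE.
set v := delta_mx 0 i.
have DFk (k : 'I_d) : is_derive w v (fun u => F u 0 k) ('J F w i k).
  have hd : (fun h : R => h^-1 *: (F (h *: v + w) - F w)) @ 0^' --> 'D_v F w.
    exact: (diff_derivable dF).
  have hk : (fun h : R => h^-1 *: (F (h *: v + w) 0 k - F w 0 k)) @ 0^'
      --> 'J F w i k.
    have -> : 'J F w i k = 'D_v F w 0 k.
      by rewrite deriveEjacobian// -rowE [RHS]mxE.
    have -> : (fun h : R => h^-1 *: (F (h *: v + w) 0 k - F w 0 k)) =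
        (fun N : 'rV[R]_d => N 0 k) \o
          (fun h : R => h^-1 *: (F (h *: v + w) - F w)).
      by apply/funext => h /=; rewrite !mxE.
    exact: (continuous_cvg _ (@coord_continuous _ _ _ 0 k _) hd).
  apply: DeriveDef; first by apply/cvg_ex; exists ('J F w i k).
  exact: cvg_lim hk.
have -> : (fun u => 2^-1 * enorm (F u) ^+ 2) =
    2^-1 *: \sum_(k < d) (fun u => F u 0 k) ^+ 2.
  apply/funext => u; rewrite /enorm sqr_sqrtr; last first.
    by apply: sumr_ge0 => k _; exact: sqr_ge0.
  by rewrite [RHS]/= !fctE fct_sumE.
rewrite derive_val scaler_sumr; apply: eq_bigr => k _.
by rewrite /= expr1 !mxE scalerA /GRing.scale/= mulrA mulVf ?mul1r.
Qed.

Definition momentum_step (R : realType) (d : nat) (alpha beta : R)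
    (G : 'rV[R]_d -> 'rV[R]_d) (w w' : 'rV[R]_d) : 'rV[R]_d :=
  w - alpha *: G w + beta *: (w - w').

Definition converges_locally_at_rate (R : realType) (d : nat)
    (V : 'rV[R]_d -> 'rV[R]_d -> 'rV[R]_d) (ws : 'rV[R]_d) (rho : R) : Prop :=
  V ws ws = ws /\
  exists (U : set 'rV[R]_d) (C : R), nbhs ws U /\
    forall w : nat -> 'rV[R]_d,
      U (w 0%N) -> U (w 1%N) ->
      (forall t, w t.+2 = V (w t.+1) (w t)) ->
      forall t, enorm (w t - ws) <= C * rho ^+ t.

(* Main.v *)
(* Write [K] for the derivative of [F] at [ws], [B = K / L] and
   [kappa = gamma / L], so that [kappa |x| <= |x B| <= |x|] by the singular value
   bounds.  With [alpha = gamma^2 / L^3] and [beta = (1 - kappa / 2)^2], the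
   linearized method reads
     [x+ = (1 + beta) x - x B B^T - beta y - kappa^2 x B].
   Without the term [kappa^2 x B] it multiplies a quadratic energy by exactly
   [beta], and the energy controls [|x B|^2].  So the terms of size at most
   [eta |x B|], namely [kappa^2 x B] and the nonlinear remainder, change the
   factor to at most [beta (1 + 3 eta)^2], for [eta = kappa^2 + eps].  As
   [sqrt 2 - 1 < 1 / 2], there is room for [eps] in
   [(1 - kappa / 2) (1 + 3 eta) <= 1 - (sqrt 2 - 1) kappa + 3 kappa^2]. *)

Require Import Defs.
From mathcomp Require Import all_boot all_order all_algebra.
From mathcomp Require Import all_classical all_reals all_analysis.
From mathcomp Require Import ring lra.
Import Order.TTheory GRing.Theory Num.Theory.
Import numFieldNormedType.Exports.
Local Open Scope classical_set_scope.
Local Open Scope ring_scope.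

(** * Euclidean inner product of row vectors *)

Definition dot {R : realType} {d : nat} (u v : 'rV[R]_d) : R := (u *m v^T) 0 0.

Section DotProduct.
Context {R : realType} {d : nat}.
Implicit Types (u v w : 'rV[R]_d) (A : 'M[R]_d) (a : R).

Lemma dotE u v : dot u v = \sum_i u 0 i * v 0 i.
Proof. by rewrite /dot mxE; apply: eq_bigr => i _; rewrite mxE. Qed.

Lemma dotC u v : dot u v = dot v u.
Proof. by rewrite !dotE; apply: eq_bigr => i _; rewrite mulrC. Qed.

Lemma dotDl u v w : dot (u + v) w = dot u w + dot v w.
Proof. by rewrite /dot mulmxDl mxE. Qed.

Lemma dotDr u v w : dot u (v + w) = dot u v + dot u w.
Proof. by rewrite dotC dotDl !(dotC u). Qed.

Lemma dotZl a u v : dot (a *: u) v = a * dot u v.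
Proof. by rewrite /dot -scalemxAl mxE. Qed.

Lemma dotZr a u v : dot u (a *: v) = a * dot u v.
Proof. by rewrite dotC dotZl dotC. Qed.

Lemma dotNl u v : dot (- u) v = - dot u v.
Proof. by rewrite -scaleN1r dotZl mulN1r. Qed.

Lemma dotNr u v : dot u (- v) = - dot u v.
Proof. by rewrite dotC dotNl dotC. Qed.

Definition dot_linear := (dotDl, dotDr, dotZl, dotZr, dotNl, dotNr).

Lemma dot_mulmx u v A : dot (u *m A) v = dot u (v *m A^T).
Proof. by rewrite /dot trmx_mul trmxK mulmxA. Qed.

Lemma dot_ge0 u : 0 <= dot u u.
Proof. by rewrite dotE sumr_ge0// => i _; rewrite -expr2 sqr_ge0. Qed.

Lemma dot_eq0 u : (dot u u == 0) = (u == 0).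
Proof.
apply/eqP/eqP => [|->]; last by rewrite /dot mul0mx mxE.
rewrite dotE => /eqP; rewrite psumr_eq0; last first.
  by move=> i _; rewrite -expr2 sqr_ge0.
move=> /allP u0; apply/rowP => i; rewrite mxE; apply/eqP.
by have := u0 i (mem_index_enum i); rewrite /= mulf_eq0 orbb.
Qed.

Lemma dot_gt0 u : u != 0 -> 0 < dot u u.
Proof. by move=> u0; rewrite lt_neqAle dot_ge0 eq_sym dot_eq0 u0. Qed.

Lemma enorm_sqr u : enorm u ^+ 2 = dot u u.
Proof.
rewrite /enorm sqr_sqrtr; last by apply: sumr_ge0 => i _; exact: sqr_ge0.
by rewrite dotE; apply: eq_bigr => i _; rewrite expr2.
Qed.

(** Expand [0 <= |2 a u - v|^2] and divide by [4 a]. *)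
Lemma dot_young u v a : 0 < a -> dot u v <= a * dot u u + dot v v / (4 * a).
Proof.
move=> a0; have := dot_ge0 ((2 * a) *: u - v).
rewrite !dot_linear (dotC v u) => h.
rewrite -(ler_pM2r (_ : 0 < 4 * a)) ?mulr_gt0//.
have -> : (a * dot u u + dot v v / (4 * a)) * (4 * a) =
    4 * a ^+ 2 * dot u u + dot v v by field; rewrite gt_eqF.
nra.
Qed.

End DotProduct.

(** * The sup norm and its comparison with the Euclidean norm *)

Lemma mx_entry_norm {R : realType} {m n : nat} (M : 'M[R]_(m, n)) i j :
  `|M i j| <= `|M|.
Proof.
rewrite [leRHS]/Num.Def.normr/= mx_normrE.
exact: (le_bigmax _ (fun ij : 'I_m * 'I_n => `|M ij.1 ij.2|) (i, j)).
Qed.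

Lemma mx_norm_le {R : realType} {m n : nat} (M : 'M[R]_(m, n)) (b : R) :
  0 <= b -> (forall i j, `|M i j| <= b) -> `|M| <= b.
Proof.
move=> b0 Mb; rewrite [leLHS]/Num.Def.normr/= mx_normrE.
by apply: bigmax_le => // -[i j] _; exact: Mb.
Qed.

Lemma sqr_norm_le_dot {R : realType} {d : nat} (v : 'rV[R]_d) :
  `|v| ^+ 2 <= dot v v.
Proof.
rewrite -enorm_sqr ler_sqr ?nnegrE ?sqrtr_ge0//.
apply: mx_norm_le => [|i j]; first exact: sqrtr_ge0.
rewrite ord1 -sqrtr_sqr ler_wsqrtr// (bigD1 j)//= lerDl.
by apply: sumr_ge0 => k _; exact: sqr_ge0.
Qed.

Lemma dot_le_sqr_norm {R : realType} {d : nat} (v : 'rV[R]_d) :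
  dot v v <= d%:R * `|v| ^+ 2.
Proof.
rewrite dotE -[d in d%:R]card_ord mulr_natl -sumr_const; apply: ler_sum => i _.
by rewrite -expr2 -real_normK ?num_real// ler_sqr ?nnegrE// mx_entry_norm.
Qed.

Lemma mulmx_norm_le {R : realType} {d : nat} (v : 'rV[R]_d) (A : 'M[R]_d) :
  `|v *m A| <= d%:R * (`|v| * `|A|).
Proof.
apply: mx_norm_le => [|i j]; first by rewrite !mulr_ge0.
rewrite mxE (le_trans (ler_norm_sum _ _ _))//.
rewrite -[d in d%:R]card_ord mulr_natl -sumr_const; apply: ler_sum => k _.
by rewrite normrM ler_pM// mx_entry_norm.
Qed.

(** * Quadratic forms and extremal eigenvalues of symmetric matrices *)

Lemma quadratic_form_continuous {R : realType} {d : nat} (A : 'M[R]_d) :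
  continuous (fun v : 'rV[R]_d => dot (v *m A) v).
Proof.
have -> : (fun v : 'rV[R]_d => dot (v *m A) v) =
    fun v : 'rV[R]_d => \sum_i (\sum_j v 0 j * A j i) * v 0 i.
  by apply/funext => v; rewrite dotE; apply: eq_bigr => i _; rewrite mxE.
have coord i : continuous (fun v : 'rV[R]_d => v 0 i).
  exact: coord_continuous.
have lin i : continuous (fun v : 'rV[R]_d => \sum_j v 0 j * A j i).
  apply: continuous_big => [|j _ v]; first exact: add_continuous.
  exact: (continuousM (coord j v) (@cst_continuous _ _ (A j i) v)).
apply: continuous_big => [|i _ v]; first exact: add_continuous.
exact: (continuousM (lin i v) (coord i v)).
Qed.

(* The minimum of the quadratic form on the unit sphere is an eigenvalue: at a
   minimizer the positive semidefinite form [A - m] vanishes. *)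
Lemma symmetric_min_eigenvalue {R : realType} {d : nat} (A : 'M[R]_d)
    (x : 'rV[R]_d) :
  A^T = A -> x != 0 ->
  exists2 m : R, eigenvalue A m &
    forall v : 'rV[R]_d, m * dot v v <= dot (v *m A) v.
Proof.
move=> symA x0.
have unit_ex (v : 'rV[R]_d) : v != 0 ->
    exists2 a, a ^+ 2 * dot v v = 1 & 0 < a.
  move=> /dot_gt0 v0; exists (Num.sqrt (dot v v))^-1.
    by rewrite exprVn sqr_sqrtr ?mulVf ?gt_eqF// ltW.
  by rewrite invr_gt0 sqrtr_gt0.
pose S := [set v : 'rV[R]_d | dot v v = 1].
have S0 : S !=set0.
  have [a a1 _] := unit_ex _ x0; exists (a *: x).
  by rewrite /S/= dotZl dotZr mulrA -expr2.
have Sbnd : bounded_set S.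
  exists 1; split=> // b b1 v /= Sv.
  have := sqr_norm_le_dot v; rewrite Sv => v1.
  apply: le_trans (ltW b1).
  by rewrite -ler_sqr ?nnegrE// expr1n.
have Scl : closed S.
  have -> : S = (fun v : 'rV[R]_d => dot (v *m 1%:M) v) @^-1` [set 1].
    by apply/funext => v; rewrite /S/= mulmx1.
  apply: closed_comp; last exact: closed_eq.
  by move=> v _; exact: quadratic_form_continuous.
have [c Sc cmin] : exists2 c, c \in S &
    forall v, v \in S -> dot (c *m A) c <= dot (v *m A) v.
  apply: (EVT_min_rV S0 (bounded_closed_compact Sbnd Scl)).
  exact/continuous_subspaceT/quadratic_form_continuous.
move: Sc; rewrite inE /S/= => c1.
set m := dot (c *m A) c in cmin.
have mmin (v : 'rV[R]_d) : m * dot v v <= dot (v *m A) v.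
  have [->|v0] := eqVneq v 0; first by rewrite mul0mx /dot mul0mx mxE mulr0.
  have [a a1 a0] := unit_ex _ v0.
  have: m <= dot ((a *: v) *m A) (a *: v).
    by apply: cmin; rewrite inE /S/= dotZl dotZr mulrA -expr2.
  rewrite -scalemxAl dotZl dotZr mulrA -expr2 => h.
  rewrite -(ler_pM2l (_ : 0 < a ^+ 2)) ?exprn_gt0//.
  by rewrite mulrCA a1 mulr1.
exists m => //; apply/eigenvalueP; exists c; last first.
  by apply: contra_eq_neq c1 => ->; rewrite /dot mul0mx mxE eq_sym oner_neq0.
apply/eqP; rewrite -subr_eq0 -dot_eq0; apply/eqP.
set z := _ - _; set b := dot (z *m A) z - m * dot z z.
have zA : dot z z = dot (c *m A) z - m * dot c z.
  by rewrite /z 1?[in LHS]dotDl dotNl dotZl.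
have b0 : 0 <= b by rewrite subr_ge0.
have bE : dot (z *m A) z = m * dot z z + b by rewrite addrC subrK.
clearbody b z.
apply/eqP; rewrite eq_le dot_ge0 andbT leNgt; apply/negP => z0.
(* Moving from [c] to [c - s z], with [z = c A - m c], changes the form [A - m] by
   [- 2 s |z|^2 + s^2 b]. This step size makes [s b < |z|^2], so the change would be negative,
   against minimality. *)
pose s := dot z z / (b + 1).
have sb : s * (b + 1) = dot z z by rewrite divfK// gt_eqF//; lra.
have s0 : 0 < s by rewrite divr_gt0//; lra.
have := mmin (c - s *: z).
rewrite mulmxBl -scalemxAl !dot_linear (dotC z c) c1 -/m.
have -> : dot (z *m A) c = dot (c *m A) z by rewrite dot_mulmx symA dotC.
rewrite bE => h.
have : 0 <= - 2 * dot z z + s * b.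
  rewrite -(pmulr_rge0 _ s0); rewrite zA in h *; nra.
nra.
Qed.

(** * Decay of a quadratic energy along the perturbed linear iteration *)

Section Energy.
Context {R : realType} {d : nat} (B : 'M[R]_d) (kappa : R).
Hypotheses (kappa_gt0 : 0 < kappa) (kappa_le1 : kappa <= 1).
Hypothesis B_lower : forall v : 'rV[R]_d,
  kappa ^+ 2 * dot v v <= dot (v *m B) (v *m B).
Hypothesis B_upper : forall v : 'rV[R]_d, dot (v *m B) (v *m B) <= dot v v.
Implicit Types x y e : 'rV[R]_d.

Let r : R := 1 - kappa / 2.
Let beta : R := r ^+ 2.
Let P x : 'rV[R]_d := (1 + beta) *: x - x *m B *m B^T.

(* With the momentum [beta = (1 - kappa / 2)^2], the unperturbed iteration
   [x+ = P x - beta y] multiplies this quadratic form by exactly [beta]. *)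
Definition energy x y : R := dot x x - dot x (P y) + beta * dot y y.

Let r_ge : 1 / 2 <= r.
Proof. by have := kappa_le1; rewrite /r; lra. Qed.

Let r_le1 : r <= 1.
Proof. by have := kappa_gt0; rewrite /r; lra. Qed.

Let r_gt0 : 0 < r.
Proof. by have := r_ge; lra. Qed.

Let beta_gt0 : 0 < beta.
Proof. exact: exprn_gt0. Qed.

Let beta_le1 : beta <= 1.
Proof. by rewrite exprn_ile1// ltW. Qed.

Lemma dot_gram x y : dot x (y *m B *m B^T) = dot (x *m B) (y *m B).
Proof. by rewrite [RHS]dot_mulmx. Qed.

(** The bound on [B] passes to its transpose: with [z = x B] and [w = z B^T], expand
    [0 <= |z - w B|^2], where [z . (w B) = |w|^2] and [|w B| <= |w|]. *)
Lemma gram_contraction x :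
  dot (x *m B *m B^T) (x *m B *m B^T) <= dot (x *m B) (x *m B).
Proof.
set z := x *m B; set w := z *m B^T.
have zw : dot z (w *m B) = dot w w.
  by rewrite [in RHS]/w [RHS]dot_mulmx trmxK.
have := dot_ge0 (z - w *m B).
rewrite !dot_linear (dotC _ z) zw; have := B_upper w; lra.
Qed.

(** Complete the square: as [P] is symmetric, [4 beta energy x y] equals [|P x - 2 beta y|^2 + 4
    beta |x|^2 - |P x|^2]. The last two terms sum to [2 (1 + beta) |x B|^2 - (1 - beta)^2 |x|^2 - |x
    B B^T|^2]. *)
Lemma energy_lower x y :
  dot (P x - (2 * beta) *: y) (P x - (2 * beta) *: y)
    + dot (x *m B) (x *m B) / 2 <= 4 * beta * energy x y.
Proof.
have h1 := gram_contraction x; have h2 := B_lower x.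
rewrite /energy /P; set s := x *m B *m B^T in h1 *.
have sx : dot s x = dot (x *m B) (x *m B) by rewrite dotC dot_gram.
have xs : dot x s = dot (x *m B) (x *m B) by rewrite dot_gram.
have sy : dot y s = dot (x *m B) (y *m B) by rewrite dot_gram dotC.
rewrite !dot_linear sx xs (dot_gram x y) (dotC s y) sy (dotC y x) in h2 *.
set N := dot (x *m B) (x *m B) in h1 h2 *; set X := dot x x in h2 *.
have N0 : 0 <= N by exact: dot_ge0.
(* The choice of momentum enters here: [1 - beta = (1 + r) kappa / 2], so [B_lower] turns [|x|^2]
   into a multiple of [|x B|^2] small enough to leave [|x B|^2 / 2] to spare. *)
have h3 : (1 - beta) ^+ 2 * X <= (1 + r) ^+ 2 * N / 4.
  have -> : (1 - beta) ^+ 2 * X = (1 + r) ^+ 2 / 4 * (kappa ^+ 2 * X).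
    by rewrite /beta /r; field.
  have -> : (1 + r) ^+ 2 * N / 4 = (1 + r) ^+ 2 / 4 * N by field.
  by rewrite ler_wpM2l// divr_ge0// sqr_ge0.
have h4 : 3 / 2 * N <= (2 * (1 + beta) - (1 + r) ^+ 2 / 4) * N.
  apply: ler_wpM2r => //; rewrite /beta.
  by have := sqr_ge0 (r - 1); have := sqr_ge0 r; lra.
nra.
Qed.

Lemma energy_ge0 x y : 0 <= energy x y.
Proof.
have := energy_lower x y; have := dot_ge0 (x *m B).
have := dot_ge0 (P x - (2 * beta) *: y) => h1 h2 h3.
by rewrite -(pmulr_rge0 _ (mulr_gt0 (ltr0Sn _ 3) beta_gt0)); lra.
Qed.

(** Turns decay of the energy into decay of the iterates. *)
Lemma dot_le_energy x y : kappa ^+ 2 * dot x x <= 8 * energy x y.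
Proof.
apply: le_trans (B_lower x) _.
have := energy_lower x y; have := energy_ge0 x y; have := beta_le1.
have := dot_ge0 (P x - (2 * beta) *: y); nra.
Qed.

(** Makes the initial energy small when the first two iterates are. *)
Lemma energy_upper x y : energy x y <= 4 * (dot x x + dot y y).
Proof.
rewrite /energy /P !dot_linear dot_gram.
have b1 := beta_le1; have b0 := ltW beta_gt0.
have hx := B_upper x; have hy := B_upper y.
have h1 := dot_ge0 (x + y); have h2 := dot_ge0 (x *m B - y *m B).
rewrite !dot_linear (dotC y x) (dotC (y *m B)) in h1 h2.
have X0 := dot_ge0 x; have Y0 := dot_ge0 y.
nra.
Qed.

(** For [u = P x - 2 beta y], the new energy is [beta energy x y + u . e + |e|^2]. Young's
    inequality with weight [eta] and [energy_lower] bound the two extra terms by [4 eta] and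
    [8 eta^2] times [beta energy x y], and [1 + 4 eta + 8 eta^2 <= (1 + 3 eta)^2]. *)
Lemma energy_step x y e (eta : R) :
  0 < eta -> dot e e <= eta ^+ 2 * dot (x *m B) (x *m B) ->
  energy (P x - beta *: y + e) x <= (r * (1 + 3 * eta)) ^+ 2 * energy x y.
Proof.
move=> eta0 he.
have expand : energy (P x - beta *: y + e) x =
    beta * energy x y + dot (P x - (2 * beta) *: y) e + dot e e.
  rewrite /energy.
  have -> : dot x (P y) = dot y (P x).
    by rewrite /P !dot_linear !dot_gram (dotC x y) (dotC (x *m B)).
  move: (P x) => p.
  rewrite !dot_linear (dotC y p) (dotC e y) (dotC e p).
  ring.
have h1 := energy_lower x y; have E0 := energy_ge0 x y.
have := dot_young (P x - (2 * beta) *: y) e _ eta0.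
set N := dot (x *m B) (x *m B) in he h1 *; set u := P x - (2 * beta) *: y in expand h1 *.
have N0 : 0 <= N by exact: dot_ge0.
have -> : dot e e / (4 * eta) = (dot e e / eta) / 4.
  by field; rewrite gt_eqF.
have he' : dot e e / eta <= eta * N by rewrite ler_pdivrMr//; nra.
have u0 := dot_ge0 u.
rewrite expand exprMn -/beta; set bE := beta * energy x y.
have bE0 : 0 <= bE by rewrite mulr_ge0// sqr_ge0.
have -> : beta * (1 + 3 * eta) ^+ 2 * energy x y = (1 + 3 * eta) ^+ 2 * bE.
  by rewrite /bE; ring.
have h1' : dot u u + N / 2 <= 4 * bE by rewrite mulrA.
have h2 : eta * (dot u u + N / 2) <= eta * (4 * bE) by rewrite ler_pM2l.
have h3 : eta ^+ 2 * N <= eta ^+ 2 * (8 * bE) by rewrite ler_wpM2l ?sqr_ge0//; lra.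
have h4 : 0 <= eta * N by rewrite mulr_ge0// ltW.
have h5 : 0 <= eta * bE by rewrite mulr_ge0// ltW.
have h6 : 0 <= eta ^+ 2 * bE by rewrite mulr_ge0// sqr_ge0.
nra.
Qed.

(** A bootstrap: the perturbation is controlled only while [|x|^2 < delta], and the decay obtained
    so far gives [|x|^2 <= delta / 2], which permits the next step. *)
Lemma energy_decay (x : nat -> 'rV[R]_d) (eta rho delta : R) :
  0 < eta -> 0 < delta -> 0 < rho -> rho < 1 -> r * (1 + 3 * eta) <= rho ->
  16 * energy (x 1%N) (x 0%N) <= kappa ^+ 2 * delta ->
  (forall t, dot (x t.+1) (x t.+1) < delta ->
    exists2 e, x t.+2 = P (x t.+1) - beta *: x t + e &
      dot e e <= eta ^+ 2 * dot (x t.+1 *m B) (x t.+1 *m B)) ->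
  forall t, dot (x t.+1) (x t.+1) <= delta / 2 * (rho ^+ t) ^+ 2.
Proof.
move=> eta0 delta0 rho0 rho1 rate E0 step.
have k20 : 0 < kappa ^+ 2 by rewrite exprn_gt0.
have bound t : 16 * energy (x t.+1) (x t) <= kappa ^+ 2 * delta * (rho ^+ t) ^+ 2 ->
    dot (x t.+1) (x t.+1) <= delta / 2 * (rho ^+ t) ^+ 2.
  move=> Et; rewrite -(ler_pM2l k20).
  have := dot_le_energy (x t.+1) (x t); lra.
move=> t; apply: (bound); elim: t => [|t IH]; first by rewrite expr0 expr1n mulr1.
have small : dot (x t.+1) (x t.+1) < delta.
  apply: le_lt_trans (bound _ IH) _.
  have : (rho ^+ t) ^+ 2 <= 1 by rewrite !exprn_ile1// ?exprn_ge0// ltW.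
  nra.
have [e -> he] := step t small.
have Et := energy_step _ (x t) _ _ eta0 he.
have r0 : 0 < r * (1 + 3 * eta) by rewrite mulr_gt0//; lra.
have rate2 : (r * (1 + 3 * eta)) ^+ 2 <= rho ^+ 2.
  by rewrite ler_sqr ?nnegrE// ltW.
have := ler_wpM2r (energy_ge0 (x t.+1) (x t)) rate2.
have := ler_wpM2l (sqr_ge0 rho) IH.
rewrite [rho ^+ t.+1]exprS exprMn; lra.
Qed.

End Energy.

(** * Linearization of the consensus field and singular value bounds *)

(** The product [F w *m jacobian_mx F w] is split rather than differentiated: with [h = w - ws] and
    [J] the Jacobian at [w], [F J - h K K^T = F (J - K^T) + (F - h K) K^T], and both terms are small
    relative to [h]. *)
Lemma consensus_linearization {R : realType} {d : nat}
    (F : 'rV[R]_d -> 'rV[R]_d) (ws : 'rV[R]_d) (tau eps : R) :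
  cont_diff F -> F ws = 0 -> 0 < eps ->
  let rem w := consensus tau F w - ((w - ws) *m 'J F ws
    + tau *: ((w - ws) *m 'J F ws *m ('J F ws)^T)) in
  \forall w \near ws, dot (rem w) (rem w) <= eps * dot (w - ws) (w - ws).
Proof.
move=> [dF cJ] F0 eps0 rem_.
pose K := 'J F ws.
pose C := 1 + `|tau| * (d%:R * ((d%:R * `|K| + 1) + `|K^T|)).
have C0 : 0 <= C.
  by rewrite addr_ge0// mulr_ge0// mulr_ge0// addr_ge0// addr_ge0// mulr_ge0.
(* [C] gathers the factors in the estimate of the remainder. The cap at 1 gives [e1^2 <= e1], and
   the [+ 1] keeps the denominator positive when [d = 0]. *)
pose e1 := Num.min 1 (eps / (d%:R * C ^+ 2 + 1)).
have D0 : 0 < d%:R * C ^+ 2 + 1 by rewrite ltr_wpDl// mulr_ge0// sqr_ge0.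
have e10 : 0 < e1 by rewrite lt_min ltr01 divr_gt0.
have e11 : e1 <= 1 by rewrite ge_min lexx.
have e1e : e1 * (d%:R * C ^+ 2 + 1) <= eps.
  by rewrite -ler_pdivlMr// ge_min lexx orbT.
have near_F : \forall w \near ws,
    `|F w - (w - ws) *m K| <= e1 * `|w - ws|.
  have /eqaddoP/(_ _ e10) o := diff_locally (dF ws).
  apply/nbhs0P; apply: filterS o => h /=.
  rewrite [ws + h]addrC addrK => oh.
  by move: oh; rewrite !fctE /= F0 add0r /K /jacobian mul_rV_lin1.
have near_J : \forall w \near ws,
    `|jacobian_mx F w - jacobian_mx F ws| <= e1.
  by have /cvgrPdistC_le/(_ _ e10) := cJ ws.
apply: filterS2 near_F near_J => w.
rewrite /rem_ /=; set h := w - ws; set rem := (X in dot X X) => hF hJ.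
have {}hJ : `|jacobian_mx F w - K^T| <= e1 by [].
have remE : rem = F w - h *m K + tau *: (F w *m (jacobian_mx F w - K^T)
    + (F w - h *m K) *m K^T).
  rewrite /rem consensusE// -/K; move: h {hF rem} => h.
  rewrite mulmxBr mulmxBl addrA subrK scalerBr.
  by rewrite opprD addrACA.
have FwK : `|F w| <= (d%:R * `|K| + 1) * `|h|.
  rewrite -[F w](subrK (h *m K)) (le_trans (ler_normD _ _))//.
  have h1 := mulmx_norm_le h K; have h0 := normr_ge0 h; nra.
have remC : `|rem| <= e1 * C * `|h|.
  rewrite remE (le_trans (ler_normD _ _))// normrZ.
  have -> : e1 * C * `|h| = e1 * `|h| +
      `|tau| * (d%:R * (((d%:R * `|K| + 1) * `|h|) * e1)
      + d%:R * (e1 * `|h| * `|K^T|)) by rewrite /C; ring.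
  rewrite lerD// ler_wpM2l// (le_trans (ler_normD _ _))//.
  rewrite lerD// (le_trans (mulmx_norm_le _ _))// ler_wpM2l//.
    by rewrite ler_pM.
  by rewrite ler_wpM2r.
apply: le_trans (dot_le_sqr_norm _) _.
apply: le_trans (ler_wpM2l _ (sqr_norm_le_dot h)); last exact: ltW.
have h2 : `|rem| ^+ 2 <= (e1 * C * `|h|) ^+ 2.
  by rewrite ler_sqr// nnegrE// !mulr_ge0// ltW.
apply: le_trans (ler_wpM2l (ler0n _ _) h2) _.
rewrite exprMn mulrA ler_wpM2r ?sqr_ge0//.
apply: le_trans e1e; rewrite exprMn mulrCA expr2 -mulrA ler_pM2l//.
have d0 : 0 <= d%:R * C ^+ 2 by rewrite mulr_ge0// sqr_ge0.
nra.
Qed.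

(** Square roots of the eigenvalues of [G = A^T A] are singular values. The least eigenvalue of [G]
    gives the lower bound, that of [- G] the upper one. *)
Lemma singular_value_bounds {R : realType} {d : nat} (A : 'M[R]_d)
    (gamma L : R) (x : 'rV[R]_d) :
  0 <= gamma ->
  (forall s, singular_value A s -> gamma <= s <= L) ->
  gamma ^+ 2 * dot x x <= dot (x *m A^T) (x *m A^T) <= L ^+ 2 * dot x x.
Proof.
move=> gamma0 bnd; pose G := A^T *m A.
have symG : G^T = G by rewrite trmx_mul trmxK.
have symNG : (- G)^T = - G by rewrite linearN/= symG.
have [->|x0] := eqVneq x 0; first by rewrite mul0mx /dot mul0mx mxE !mulr0 lexx.
have GE (v : 'rV[R]_d) : dot (v *m G) v = dot (v *m A^T) (v *m A^T).
  by rewrite mulmxA dot_mulmx.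
have sv m : eigenvalue G m -> gamma ^+ 2 <= m <= L ^+ 2.
  move=> ev.
  have m0 : 0 <= m.
    have /eigenvalueP[v vG v0] := ev.
    by rewrite -(pmulr_lge0 _ (dot_gt0 _ v0)) -dotZl -vG GE dot_ge0.
  have /bnd/andP[gs sL] : singular_value A (Num.sqrt m).
    by rewrite /singular_value sqrtr_ge0 sqr_sqrtr.
  have s0 := sqrtr_ge0 m.
  by rewrite -(sqr_sqrtr m0) !ler_sqr ?nnegrE// ?gs//; exact: le_trans sL.
have [m1 /sv/andP[gm1 _] m1min] := symmetric_min_eigenvalue G x symG x0.
have [m2 ev2 m2min] := symmetric_min_eigenvalue (- G) x symNG x0.
have /sv/andP[_ m2L] : eigenvalue G (- m2).
  have /eigenvalueP[v vG v0] := ev2; apply/eigenvalueP; exists v => //.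
  by rewrite scaleNr -vG mulmxN opprK.
have := m1min x; have := m2min x; rewrite mulmxN dotNl !GE => h2 h1.
have X0 := dot_ge0 x.
by apply/andP; split; nra.
Qed.

(** * Squared triangle inequality and Euclidean neighbourhoods *)

(** The Young weight [q / (2 p)] balances the cross term: each half of its bound is [p q N / 2]. *)
Lemma dot_add_le {R : realType} {d : nat} (u v : 'rV[R]_d) (p q N : R) :
  0 < p -> 0 < q -> dot u u <= p ^+ 2 * N -> dot v v <= q ^+ 2 * N ->
  dot (u + v) (u + v) <= (p + q) ^+ 2 * N.
Proof.
move=> p0 q0 hu hv.
have := dot_young u v (q / (2 * p)) (divr_gt0 q0 (mulr_gt0 (ltr0Sn _ 1) p0)).
have h1 : q / (2 * p) * dot u u <= p * q / 2 * N.
  have -> : p * q / 2 * N = q / (2 * p) * (p ^+ 2 * N).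
    by field; rewrite gt_eqF.
  by rewrite ler_pM2l// divr_gt0// mulr_gt0.
have h2 : dot v v / (4 * (q / (2 * p))) <= p * q / 2 * N.
  have -> : p * q / 2 * N = q ^+ 2 * N / (4 * (q / (2 * p))).
    by field; rewrite !gt_eqF.
  by rewrite ler_wpM2r// invr_ge0 mulr_ge0// divr_ge0 ?mulr_ge0// ltW.
rewrite !dot_linear (dotC v u); lra.
Qed.

Lemma nbhs_dot_lt {R : realType} {d : nat} (ws : 'rV[R]_d) (q : R) :
  0 < q -> \forall w \near ws, dot (w - ws) (w - ws) < q.
Proof.
move=> q0; apply/nbhs0P.
have /(_ 0) c := @quadratic_form_continuous R d 1%:M.
have : dot ((0 : 'rV[R]_d) *m 1%:M) 0 < q by rewrite mul0mx /dot mul0mx mxE.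
move=> /(cvgr_lt _ c); apply: filterS => h.
by rewrite mulmx1 [ws + h]addrC addrK.
Qed.

(** The sup norm is at most the Euclidean norm, so a Euclidean ball lies in the sup-norm ball of the
    same radius. *)
Lemma near_dot_lt {R : realType} {d : nat} (ws : 'rV[R]_d)
    (Q : 'rV[R]_d -> Prop) :
  (\forall w \near ws, Q w) ->
  exists2 delta : R, 0 < delta &
    forall w, dot (w - ws) (w - ws) < delta -> Q w.
Proof.
move=> /nbhs_ballP[e /= e0 eQ]; exists (e ^+ 2); first by rewrite exprn_gt0.
move=> w hw; apply: eQ; rewrite -ball_normE /ball_/= distrC.
rewrite -ltr_sqr ?nnegrE// ?(ltW e0)//.
exact: le_lt_trans (sqr_norm_le_dot _) hw.
Qed.

(** * Choice of the parameters and passage to the nonlinear method *)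

Theorem proposition8 (R : realType) :
  exists M : R,
  forall (d : nat) (F : 'rV[R]_d -> 'rV[R]_d) (ws : 'rV[R]_d) (gamma L : R),
    twice_cont_diff F ->
    F ws = 0 ->
    0 < gamma -> gamma <= L ->
    (forall s : R, singular_value (jacobian_mx F ws) s -> gamma <= s <= L) ->
    let c := Num.sqrt 2 - 1 in
    let tau := L / gamma ^+ 2 in
    let rho := 1 - c * (gamma / L) + M * (gamma ^+ 2 / L ^+ 2) in
    rho < 1 ->
    exists alpha beta : R,
      converges_locally_at_rate
        (momentum_step alpha beta (consensus tau F)) ws rho.
Proof.
(* The constant 3 is the coefficient of [eta] in [energy_step], applied to the part [kappa^2] of
   [eta]. *)
exists 3 => d F ws gamma L [cdF _] F0 gamma0 gammaL sv c tau rho rho1.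
have L0 : 0 < L by exact: lt_le_trans gammaL.
pose kappa : R := gamma / L; pose K : 'M[R]_d := 'J F ws.
pose B : 'M[R]_d := L^-1 *: K.
have kappa0 : 0 < kappa by rewrite divr_gt0.
have kappa1 : kappa <= 1 by rewrite ler_pdivrMr ?mul1r.
have rhoE : rho = 1 - c * kappa + 3 * kappa ^+ 2 by rewrite /kappa expr_div_n.
have c12 : c < 1 / 2.
  suff : Num.sqrt 2 < 3 / 2 :> R by rewrite /c; lra.
  have s2 : Num.sqrt 2 ^+ 2 = 2 :> R by rewrite sqr_sqrtr.
  by have := sqrtr_ge0 (2 : R); nra.
have c0 : 0 <= c.
  by rewrite subr_ge0 -[1 in leLHS]sqrtr1 ler_wsqrtr// ler1n.
(* Chosen so that [alpha tau = 1 / L^2], whence [alpha tau K K^T = B B^T] and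
   [alpha K = kappa^2 B]. *)
pose alpha : R := gamma ^+ 2 / L ^+ 3.
have alpha0 : 0 < alpha by rewrite divr_gt0 ?exprn_gt0.
(* Fills the gap exactly: [rho = 1 - kappa / 2 + 3 (kappa^2 + eps)]. *)
pose eps : R := (1 / 2 - c) * kappa / 3.
have eps0 : 0 < eps by rewrite divr_gt0// mulr_gt0//; lra.
pose eta : R := kappa ^+ 2 + eps.
have kappa20 : 0 < kappa ^+ 2 by rewrite exprn_gt0.
have eta0 : 0 < eta by rewrite addr_gt0.
have rho0 : 0 < rho by rewrite rhoE; nra.
have rate : (1 - kappa / 2) * (1 + 3 * eta) <= rho.
  have -> : rho = 1 - kappa / 2 + 3 * eta.
    by rewrite rhoE /eta /eps; field.
  nra.
have BE (v : 'rV[R]_d) :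
    dot (v *m B) (v *m B) = dot (v *m K) (v *m K) / L ^+ 2.
  by rewrite /B -scalemxAr dotZl dotZr; field; rewrite gt_eqF.
have Kbnd (v : 'rV[R]_d) : gamma ^+ 2 * dot v v <= dot (v *m K) (v *m K)
    <= L ^+ 2 * dot v v.
  have := singular_value_bounds _ _ _ v (ltW gamma0) sv.
  by rewrite trmxK.
have B_lower (v : 'rV[R]_d) : kappa ^+ 2 * dot v v <= dot (v *m B) (v *m B).
  rewrite BE ler_pdivlMr ?exprn_gt0// expr_div_n mulrAC divfK; last first.
    by rewrite expf_neq0 ?gt_eqF.
  by have /andP[] := Kbnd v.
have B_upper (v : 'rV[R]_d) : dot (v *m B) (v *m B) <= dot v v.
  by rewrite BE ler_pdivrMr ?exprn_gt0// mulrC; have /andP[] := Kbnd v.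
(* With this tolerance, [alpha |rem| <= eps kappa |x| <= eps |x B|]. *)
have eps20 : 0 < (eps * kappa / alpha) ^+ 2.
  exact: exprn_gt0 _ (divr_gt0 (mulr_gt0 eps0 kappa0) alpha0).
have [delta delta0 rem_small] := near_dot_lt _ _
  (consensus_linearization F ws tau _ cdF F0 eps20).
exists alpha, ((1 - kappa / 2) ^+ 2); split.
  rewrite /momentum_step consensusE; last by case: cdF.
  by rewrite F0 mul0mx scaler0 addr0 scaler0 subrr scaler0 subr0 addr0.
(* [128 = 16 * 4 * 2]: the factor 16 in [energy_decay], the 4 in [energy_upper], and two initial
   points. *)
pose q : R := kappa ^+ 2 * delta / 128.
have q0 : 0 < q by apply: divr_gt0; [exact: mulr_gt0 | rewrite ltr0n].
(* The division by [rho] absorbs the index shift, since [energy_decay] bounds [x t.+1] by a multiple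
   of [rho ^+ t]. *)
exists [set w | dot (w - ws) (w - ws) < q], (Num.sqrt delta / rho).
split; first exact: nbhs_dot_lt.
move=> w /= w0 w1 wS.
pose x t := w t - ws.
have E0 : 16 * energy B kappa (x 1%N) (x 0%N) <= kappa ^+ 2 * delta.
  have := energy_upper B kappa kappa0 kappa1 B_upper (x 1%N) (x 0%N).
  by move: w0 w1; rewrite /q /x; lra.
have step t : dot (x t.+1) (x t.+1) < delta ->
    exists2 e, x t.+2 = (1 + (1 - kappa / 2) ^+ 2) *: x t.+1
        - x t.+1 *m B *m B^T - (1 - kappa / 2) ^+ 2 *: x t + e &
      dot e e <= eta ^+ 2 * dot (x t.+1 *m B) (x t.+1 *m B).
  move=> /rem_small hrem; pose rem := consensus tau F (w t.+1)
    - (x t.+1 *m K + tau *: (x t.+1 *m K *m K^T)).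
  have {}hrem : dot rem rem <=
      (eps * kappa / alpha) ^+ 2 * dot (x t.+1) (x t.+1) by [].
  exists (- (kappa ^+ 2 *: (x t.+1 *m B)) - alpha *: rem).
    have -> : x t.+1 *m B *m B^T = (L ^+ 2)^-1 *: (x t.+1 *m K *m K^T).
      rewrite /B [(_ *: K)^T]linearZ/= -!scalemxAr -scalemxAl scalerA.
      by rewrite -invfM -expr2.
    have -> : x t.+1 *m B = L^-1 *: (x t.+1 *m K) by rewrite /B -scalemxAr.
    have G : consensus tau F (w t.+1) =
        rem + (x t.+1 *m K + tau *: (x t.+1 *m K *m K^T)).
      by rewrite /rem subrK.
    rewrite {1}/x wS /momentum_step G.
    have -> : w t.+1 - w t = x t.+1 - x t by rewrite /x opprB addrA subrK.
    have -> : w t.+1 = x t.+1 + ws by rewrite /x subrK.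
    move: (x t.+1 *m K *m K^T) (x t.+1 *m K) (rem) (x t.+1) (x t) => a b z h y.
    apply/rowP => i; rewrite !mxE /alpha /tau /kappa.
    by field; rewrite !gt_eqF.
  apply: dot_add_le => //.
    rewrite dotNl dotNr opprK dotZl dotZr mulrA -expr2 ler_wpM2r ?dot_ge0//.
  rewrite dotNl dotNr opprK dotZl dotZr mulrA -expr2.
  apply: le_trans (ler_wpM2l (sqr_ge0 alpha) hrem) _.
  rewrite mulrA -exprMn mulrC [alpha * _]mulrC divfK ?gt_eqF// mulrC.
  by rewrite exprMn -mulrA ler_wpM2l ?sqr_ge0.
have decay := energy_decay B kappa kappa0 kappa1 B_lower B_upper x eta rho delta
  eta0 delta0 rho0 rho1 rate E0 step.
have sd0 := sqrtr_ge0 delta.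
move=> t; rewrite -ler_sqr ?nnegrE ?sqrtr_ge0//; last first.
  by rewrite mulr_ge0 ?divr_ge0 ?exprn_ge0// ltW.
rewrite enorm_sqr -/(x t); case: t => [|t].
  rewrite expr0 mulr1 expr_div_n sqr_sqrtr ?(ltW delta0)//.
  rewrite ler_pdivlMr ?exprn_gt0//.
  have : rho ^+ 2 <= 1 by rewrite exprn_ile1// ltW.
  have : kappa ^+ 2 <= 1 by rewrite exprn_ile1// ltW.
  have := dot_ge0 (x 0%N); move: w0; rewrite /q -/(x 0%N).
  nra.
rewrite [rho ^+ _]exprS mulrA divfK ?gt_eqF// exprMn sqr_sqrtr ?(ltW delta0)//.
apply: le_trans (decay t) _; rewrite ler_wpM2r ?sqr_ge0//; lra.
Qed.
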